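(* Let $\beta,\rho>0$ and $y\in\mathbb{R}^n$. Then the multifunction $\mathcal M$ is nonempty, compact valued and upper-semicontinuous. For any $M\in\mathcal M(y)$, both $M$ and $I_n-M$ are symmetric and positive semidefinite. Moreover, there exists a neighborhood $\mathcal Y$ of $y$ such that for all $u\in\mathcal Y$, \[ \mathrm{Prox}_p(u)-\mathrm{Prox}_p(y)-M(u-y)=0\quad\forall M\in\mathcal M(u). \]
   Context: $p(x):=\beta\|x\|_1+\rho\sum_{1\le i<j\le n}|x_i-x_j|$ and $\mathrm{Prox}_p(y):=\operatorname{argmin}_x\{\tfrac12\|x-y\|^2+p(x)\}$. $S_\rho(y):=\operatorname{argmin}_x\{\tfrac12\|x-y\|^2+\rho\sum_{i<j}|x_i-x_j|\}$; it is known that $\mathrm{Prox}_p(y)=\mathrm{Prox}_{\beta\|\cdot\|_1}(S_\rho(y))$. $w\in\mathbb{R}^n$, $w_k=n-2k+1$. $\mathcal D:=\{x: x_1\ge\cdots\ge x_n\}$, $\Pi_{\mathcal D}$ the Euclidean projection. $B\in\mathbb{R}^{(n-1)\times n}$ with $Bx=(x_1-x_2,\dots,x_{n-1}-x_n)^T$, $B_i$ its $i$-th row, $B_K$ rows indexed by $K$. For each $y$, $P_y$ is a fixed permutation matrix such that $P_yy$ has non-increasing components. For $v\in\mathbb{R}^n$: $\mathcal M_{\mathcal D}(v)$ is the set of $\lambda\in\mathbb{R}^{n-1}$ with $\Pi_{\mathcal D}(v)-v+B^T\lambda=0$, $B\Pi_{\mathcal D}(v)\ge0$, $\lambda\le0$,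 $\lambda^TB\Pi_{\mathcal D}(v)=0$; $\mathcal I_{\mathcal D}(v):=\{i: B_i\Pi_{\mathcal D}(v)=0\}$; $\mathcal K_{\mathcal D}(v):=\{K\subseteq\{1,\dots,n-1\}:\exists\lambda\in\mathcal M_{\mathcal D}(v),\ \mathrm{supp}(\lambda)\subseteq K\subseteq\mathcal I_{\mathcal D}(v),\ B_K\text{ full row rank}\}$; $\mathcal Q_{\mathcal D}(v):=\{I_n-B_K^T(B_KB_K^T)^{-1}B_K:K\in\mathcal K_{\mathcal D}(v)\}$; $\mathcal Q_{S_\rho}(y):=\{P_y^T\widehat QP_y:\widehat Q\in\mathcal Q_{\mathcal D}(P_yy-\rho w)\}$. For $\eta\in\mathbb{R}^n$, $\partial_B\mathrm{Prox}_{\beta\|\cdot\|_1}(\eta)$ is the set of diagonal matrices $\mathrm{Diag}(q)$ with $q_i=0$ if $|\eta_i|<\beta$, $q_i\in\{0,1\}$ if $|\eta_i|=\beta$, $q_i=1$ if $|\eta_i|>\beta$. Finally $\mathcal M(y):=\{M\in\mathcal S^n: M=\Theta Q,\ \Theta\in\partial_B\mathrm{Prox}_{\beta\|\cdot\|_1}(S_\rho(y)),\ Q\in\mathcal Q_{S_\rho}(y)\}$, where $\mathcal S^n$ is the set of symmetric $n\times n$ matrices. *)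

(* Defs.v *)
From HB Require Import structures.
From Stdlib Require Import Reals ClassicalEpsilon FunctionalExtensionality.
From mathcomp Require Import all_boot all_algebra all_fingroup.
Set Implicit Arguments. Unset Strict Implicit. Unset Printing Implicit Defensive.

Definition R_eqb (x y : R) : bool := if Req_EM_T x y then true else false.
Lemma R_eqP : Equality.axiom R_eqb.
Proof. move=> x y; rewrite /R_eqb; case: Req_EM_T => h; [exact: ReflectT|exact: ReflectF]. Qed.
HB.instance Definition _ := hasDecEq.Build R R_eqP.

Definition R_find (P : pred R) (n : nat) : option R :=
  match excluded_middle_informative (exists x, P x) with
  | left h => Some (proj1_sig (constructive_indefinite_description _ h))
  | right _ => None end.
Lemma R_find_correct P n x : R_find P n = Some x -> P x.
Proof. rewrite /R_find; case: excluded_middle_informative => // h [<-].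
by case: constructive_indefinite_description. Qed.
Lemma R_find_complete (P : pred R) : (exists x, P x) -> exists n, R_find P n.
Proof. move=> h; exists 0%N; rewrite /R_find; by case: excluded_middle_informative. Qed.
Lemma R_find_ext (P Q : pred R) : P =1 Q -> R_find P =1 R_find Q.
Proof. by move=> /functional_extensionality ->. Qed.
HB.instance Definition _ := hasChoice.Build R R_find_correct R_find_complete R_find_ext.

Lemma R_addA : associative Rplus.
Proof. move=> x y z; by rewrite Rplus_assoc. Qed.
Lemma R_mulA : associative Rmult.
Proof. move=> x y z; by rewrite Rmult_assoc. Qed.
Lemma R_addNr : left_inverse (IZR 0) Ropp Rplus.
Proof. move=> x; exact: Rplus_opp_l. Qed.
HB.instance Definition _ := @GRing.isZmodule.Build R (IZR 0) Ropp Rplus R_addA Rplus_comm Rplus_0_l R_addNr.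
Lemma R_one_neq0 : (IZR 1) != (IZR 0) :> R.
Proof. apply/eqP; exact: R1_neq_R0. Qed.
Lemma R_mulDl : left_distributive Rmult Rplus.
Proof. move=> x y z; exact: Rmult_plus_distr_r. Qed.
HB.instance Definition _ := @GRing.Zmodule_isComNzRing.Build R (IZR 1) Rmult R_mulA Rmult_comm Rmult_1_l R_mulDl R_one_neq0.
Definition R_inv (x : R) : R := if Req_EM_T x 0 then IZR 0 else Rinv x.
Lemma R_mulVf (x : R) : x != IZR 0 -> Rmult (R_inv x) x = IZR 1.
Proof. move/eqP=> h; rewrite /R_inv; destruct (Req_EM_T x (IZR 0)) as [e|ne]; [by case: h|exact: Rinv_l]. Qed.
Lemma R_inv0 : R_inv (IZR 0) = IZR 0.
Proof. rewrite /R_inv; by destruct (Req_EM_T (IZR 0) (IZR 0)). Qed.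
HB.instance Definition _ := GRing.ComNzRing_isField.Build R R_mulVf R_inv0.

Local Open Scope ring_scope.

Notation vecR n := 'cV[R]_n.

Definition norm1 {n} (x : vecR n) : R := \sum_(i < n) Rabs (x i 0).
Definition sqnorm {n} (x : vecR n) : R := \sum_(i < n) (x i 0) ^+ 2.
Definition pairsum {n} (x : vecR n) : R :=
  \sum_(i < n) \sum_(j < n | (i < j)%N) Rabs (x i 0 - x j 0).

Definition pfun {n} (beta rho : R) (x : vecR n) : R :=
  beta * norm1 x + rho * pairsum x.

Definition is_argmin {T : Type} (f : T -> R) (x : T) : Prop :=
  forall z, Rle (f x) (f z).

(* argmin (the minimizer, chosen by Hilbert's epsilon; it is unique here) *)
Definition argmin {n} (f : vecR n -> R) : vecR n :=
  epsilon (inhabits 0) (is_argmin f).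

Definition Prox_p {n} (beta rho : R) (y : vecR n) : vecR n :=
  argmin (fun x => 2^-1 * sqnorm (x - y) + pfun beta rho x).

Definition S_rho {n} (rho : R) (y : vecR n) : vecR n :=
  argmin (fun x => 2^-1 * sqnorm (x - y) + rho * pairsum x).

(* w_k = n - 2k + 1 for k = 1..n ; 0-based entry k holds w_{k+1} *)
Definition wvec (n : nat) : vecR n :=
  \col_(k < n) (n%:R - 2 * (k.+1)%:R + 1).

Definition inD {n} (x : vecR n) : Prop :=
  forall i j : 'I_n, (i <= j)%N -> Rle (x j 0) (x i 0).

Definition projD {n} (v : vecR n) : vecR n :=
  epsilon (inhabits 0)
    (fun x => inD x /\ forall z, inD z -> Rle (sqnorm (x - v)) (sqnorm (z - v))).

(* B x = (x_1 - x_2, ..., x_{n-1} - x_n)^T *)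
Definition Bmat (n : nat) : 'M[R]_(n.-1, n) :=
  \matrix_(i < n.-1, j < n) ((j == i :> nat)%:R - (j == i.+1 :> nat)%:R).

Definition MD {n} (v : vecR n) (lam : vecR n.-1) : Prop :=
  let x := projD v in
  [/\ x - v + (Bmat n)^T *m lam = 0,
      (forall i, Rle 0 ((Bmat n *m x) i 0)),
      (forall i, Rle (lam i 0) 0) &
      (lam^T *m (Bmat n *m x)) 0 0 = 0].

Definition ID {n} (v : vecR n) : {set 'I_n.-1} :=
  [set i | (Bmat n *m projD v) i 0 == 0].

Definition BK {n} (K : {set 'I_n.-1}) : 'M[R]_(#|K|, n) :=
  rowsub (fun k : 'I_#|K| => enum_val k) (Bmat n).

Definition KD {n} (v : vecR n) (K : {set 'I_n.-1}) : Prop :=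
  [/\ exists lam, MD v lam /\ (forall i, lam i 0 != 0 -> i \in K),
      K \subset ID v &
      row_free (BK K)].

Definition projK {n} (K : {set 'I_n.-1}) : 'M[R]_n :=
  1%:M - (BK K)^T *m invmx (BK K *m (BK K)^T) *m BK K.

Definition QD {n} (v : vecR n) (Q : 'M[R]_n) : Prop :=
  exists K, KD v K /\ Q = projK K.

Definition QS {n} (Psel : vecR n -> 'S_n) (rho : R) (y : vecR n) (Q : 'M[R]_n) : Prop :=
  let P := perm_mx (Psel y) in
  exists Qh, QD (P *m y - rho *: wvec n) Qh /\ Q = P^T *m Qh *m P.

(* partial_B Prox_{beta ||.||_1}(eta) *)
Definition dBprox1 {n} (beta : R) (eta : vecR n) (Theta : 'M[R]_n) : Prop :=
  exists q : 'I_n -> R,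
    Theta = diag_mx (\row_i q i) /\
    forall i,
      [/\ (Rlt (Rabs (eta i 0)) beta -> q i = 0),
          (Rabs (eta i 0) = beta -> q i = 0 \/ q i = 1) &
          (Rlt beta (Rabs (eta i 0)) -> q i = 1)].

Definition Mmap {n} (beta rho : R) (Psel : vecR n -> 'S_n) (y : vecR n)
    (M : 'M[R]_n) : Prop :=
  M^T = M /\
  exists Theta Q, [/\ dBprox1 beta (S_rho rho y) Theta, QS Psel rho y Q & M = Theta *m Q].

(* ---------------- topology (max-norm balls; equivalent to Euclidean) ---- *)

Definition ballM {m k} (A B : 'M[R]_(m, k)) (eps : R) : Prop :=
  forall i j, Rlt (Rabs (A i j - B i j)) eps.

Definition openM {m k} (S : 'M[R]_(m, k) -> Prop) : Prop :=
  forall A, S A -> exists eps, Rlt 0 eps /\ forall B, ballM A B eps -> S B.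

Definition compactM {m k} (S : 'M[R]_(m, k) -> Prop) : Prop :=
  forall (I : Type) (U : I -> 'M[R]_(m, k) -> Prop),
    (forall i, openM (U i)) ->
    (forall A, S A -> exists i, U i A) ->
    exists l : list I, forall A, S A -> exists i, List.In i l /\ U i A.

Definition usc_at {m k p q} (F : 'M[R]_(m, k) -> 'M[R]_(p, q) -> Prop)
    (y : 'M[R]_(m, k)) : Prop :=
  forall V, openM V -> (forall M, F y M -> V M) ->
    exists delta, Rlt 0 delta /\
      forall u, ballM u y delta -> forall M, F u M -> V M.

Definition upper_semicontinuous {m k p q}
    (F : 'M[R]_(m, k) -> 'M[R]_(p, q) -> Prop) : Prop :=
  forall y, usc_at F y.

Definition symmetric_mx {n} (M : 'M[R]_n) : Prop := M^T = M.
Definition psd {n} (M : 'M[R]_n) : Prop :=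
  forall v : vecR n, Rle 0 ((v^T *m M *m v) 0 0).

(* Main.v *)
(* Let v = P_y y - rho w. Isotonic regression of v has a unique multiplier lam = C^T (v -
   Pi_D(v)) (C = partial sums), so lam and Pi_D are continuous, whence K_D(u) is contained in
   K_D(v) for u near v, and Pi_D(v) is the block average of v along any K in K_D(v). The
   formula S_rho(y) = P^T Pi_D(P y - rho w) holds for every sorting P of y, because P y -
   Pi_D(v) is itself sorted, so the rearrangement inequality makes it a subgradient of rho *
   pairsum. If y has a tie then v strictly increases across it, which forces lam <> 0 there:
   the tie lies inside one block, and the conjugate of the block average does not depend on the
   sorting permutation. Hence M(u) is contained in M(y) for u near y; on such u both Pi_D and
   soft thresholding are affine with the matrices occurring in M(u). *)
Require Import Defs.
From HB Require Import structures.
From Stdlib Require Import Reals ClassicalEpsilon.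
From mathcomp Require Import all_boot all_order all_algebra all_fingroup.
From mathcomp Require Import ring lra zify.
Set Implicit Arguments. Unset Strict Implicit. Unset Printing Implicit Defensive.
Import Order.TTheory GRing.Theory Num.Theory.
Local Open Scope ring_scope.
(* Otherwise arguments of type R, as in [soft beta (- a)], are parsed in [R_scope]. *)
Bind Scope ring_scope with R.

(** * Ordered field structure on the reals *)

Definition R_leb (x y : R) : bool := if Rle_dec x y then true else false.
Definition R_ltb (x y : R) : bool := if Rlt_dec x y then true else false.

Lemma R_lebP x y : reflect (Rle x y) (R_leb x y).
Proof. by rewrite /R_leb; case: Rle_dec => h; constructor. Qed.

Lemma R_ltbP x y : reflect (Rlt x y) (R_ltb x y).
Proof. by rewrite /R_ltb; case: Rlt_dec => h; constructor. Qed.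

Lemma R_le0_add x y : R_leb 0 x -> R_leb 0 y -> R_leb 0 (x + y).
Proof. by move=> /R_lebP hx /R_lebP hy; apply/R_lebP; apply: Rplus_le_le_0_compat. Qed.

Lemma R_le0_mul x y : R_leb 0 x -> R_leb 0 y -> R_leb 0 (x * y).
Proof. by move=> /R_lebP hx /R_lebP hy; apply/R_lebP; apply: Rmult_le_pos. Qed.

Lemma R_le0_anti x : R_leb 0 x -> R_leb x 0 -> x = 0.
Proof. by move=> /R_lebP hx /R_lebP hy; apply: Rle_antisym. Qed.

Lemma R_subr_ge0 x y : R_leb 0 (y - x) = R_leb x y.
Proof.
by apply/R_lebP/R_lebP => h; [apply/Rge_le/Rminus_ge/Rle_ge | apply/Rge_le/Rge_minus/Rle_ge].
Qed.

Lemma R_le0_total x : R_leb 0 x || R_leb x 0.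
Proof.
by case: (Rle_dec 0 x) => [/R_lebP -> // | /Rnot_le_lt /Rlt_le /R_lebP ->]; rewrite orbT.
Qed.

Lemma R_ge0_norm x : R_leb 0 x -> Rabs x = x.
Proof. by move=> /R_lebP /Rle_ge; apply: Rabs_right. Qed.

Lemma R_ltb_def x y : R_ltb x y = (y != x) && R_leb x y.
Proof.
apply/R_ltbP/andP => [h|[/eqP h /R_lebP [//|//]]].
  by split; [apply/eqP/Rgt_not_eq | apply/R_lebP/Rlt_le].
by move=> e; case: h.
Qed.

HB.instance Definition _ := Num.IntegralDomain_isLeReal.Build R
  R_le0_add R_le0_mul R_le0_anti R_subr_ge0 R_le0_total Rabs_Ropp R_ge0_norm R_ltb_def.

Lemma RleP (x y : R) : reflect (Rle x y) (x <= y).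
Proof. exact: R_lebP. Qed.

Lemma RltP (x y : R) : reflect (Rlt x y) (x < y).
Proof. exact: R_ltbP. Qed.

Lemma RabsE (x : R) : Rabs x = `|x|.
Proof. by []. Qed.

(** * Inner product and squared norm *)

Definition dot {n} (x y : vecR n) : R := \sum_i x i 0 * y i 0.

Lemma dotE n (x y : vecR n) : dot x y = (x^T *m y) 0 0.
Proof. by rewrite mxE; apply: eq_bigr => i _; rewrite mxE. Qed.

Lemma dotC n (x y : vecR n) : dot x y = dot y x.
Proof. by apply: eq_bigr => i _; rewrite mulrC. Qed.

Lemma dotDl n (x y z : vecR n) : dot (x + y) z = dot x z + dot y z.
Proof. by rewrite -big_split; apply: eq_bigr => i _; rewrite mxE mulrDl. Qed.

Lemma dotZl n a (x y : vecR n) : dot (a *: x) y = a * dot x y.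
Proof. by rewrite mulr_sumr; apply: eq_bigr => i _; rewrite mxE mulrA. Qed.

Lemma dotNl n (x y : vecR n) : dot (- x) y = - dot x y.
Proof. by rewrite -scaleN1r dotZl mulN1r. Qed.

Lemma dotDr n (x y z : vecR n) : dot x (y + z) = dot x y + dot x z.
Proof. by rewrite dotC dotDl !(dotC _ x). Qed.

Lemma dotZr n a (x y : vecR n) : dot x (a *: y) = a * dot x y.
Proof. by rewrite dotC dotZl dotC. Qed.

Lemma dotNr n (x y : vecR n) : dot x (- y) = - dot x y.
Proof. by rewrite dotC dotNl dotC. Qed.

Definition dot_lin := (dotDl, dotDr, dotNl, dotNr, dotZl, dotZr).

Lemma dot_mulmxl m n (A : 'M[R]_(m, n)) x y : dot (A *m x) y = dot x (A^T *m y).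
Proof. by rewrite !dotE trmx_mul mulmxA. Qed.

Lemma dot_mulmxr m n (A : 'M[R]_(m, n)) x y : dot x (A *m y) = dot (A^T *m x) y.
Proof. by rewrite dot_mulmxl trmxK. Qed.

Lemma sqnormE n (x : vecR n) : sqnorm x = dot x x.
Proof. by apply: eq_bigr => i _; rewrite expr2. Qed.

Lemma dot_ge0 n (x y : vecR n) :
  (forall i, 0 <= x i 0) -> (forall i, 0 <= y i 0) -> 0 <= dot x y.
Proof. by move=> hx hy; apply: sumr_ge0 => i _; apply: mulr_ge0. Qed.

Lemma dotxx_ge0 n (x : vecR n) : 0 <= dot x x.
Proof. by rewrite -sqnormE; apply: sumr_ge0 => i _; apply: sqr_ge0. Qed.

Lemma sqr_le_dotxx n (x : vecR n) i : x i 0 ^+ 2 <= dot x x.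
Proof.
rewrite -sqnormE /sqnorm (bigD1 i) //= lerDl.
by apply: sumr_ge0 => j _; apply: sqr_ge0.
Qed.

Lemma dotxx_le0 n (x : vecR n) : dot x x <= 0 -> x = 0.
Proof.
move=> h; apply/matrixP => i j; rewrite (ord1 j) mxE; apply/eqP.
by rewrite -sqrf_eq0 eq_le sqr_ge0 (le_trans (sqr_le_dotxx x i)).
Qed.

Lemma sqnormB_eq0 n (x y : vecR n) : sqnorm (x - y) <= 0 -> x = y.
Proof. by rewrite sqnormE => /dotxx_le0/eqP; rewrite subr_eq0 => /eqP. Qed.

(** * Permutation matrices, the cone D and its difference matrix *)

Lemma perm_mxE n (s : 'S_n) m (A : 'M[R]_(n, m)) i j : (perm_mx s *m A) i j = A (s i) j.
Proof. by rewrite -row_permE mxE. Qed.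

Lemma perm_mxK n (s : 'S_n) m : cancel (mulmx (perm_mx s)) (@mulmx R n n m (perm_mx s)^T).
Proof. by move=> A; rewrite mulmxA tr_perm_mx -perm_mxM mulVg perm_mx1 mul1mx. Qed.

Lemma perm_mxVK n (s : 'S_n) m : cancel (mulmx (perm_mx s)^T) (@mulmx R n n m (perm_mx s)).
Proof. by move=> A; rewrite mulmxA tr_perm_mx -perm_mxM mulgV perm_mx1 mul1mx. Qed.

Lemma inDP n (x : vecR n) :
  inD x <-> forall i j : 'I_n, (i <= j)%N -> x j 0 <= x i 0.
Proof. by split=> h i j ij; apply/RleP/h. Qed.

(* Named after the values: for [x] in D, [x (hi k)] is at least [x (lo k)]. *)
Lemma hi_subproof n (k : 'I_n.-1) : (k < n)%N.
Proof. by case: k => k /=; lia. Qed.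
Lemma lo_subproof n (k : 'I_n.-1) : (k.+1 < n)%N.
Proof. by case: k => k /=; lia. Qed.
Definition hi n (k : 'I_n.-1) : 'I_n := Ordinal (hi_subproof k).
Definition lo n (k : 'I_n.-1) : 'I_n := Ordinal (lo_subproof k).

Lemma sum_indicator n (k : nat) (F : 'I_n -> R) (kn : (k < n)%N) :
  \sum_(i < n) (i == k :> nat)%:R * F i = F (Ordinal kn).
Proof.
rewrite (bigD1 (Ordinal kn)) //= eqxx mul1r big1 ?addr0 // => i ik.
by rewrite -(inj_eq val_inj) /= in ik; rewrite (negbTE ik) mul0r.
Qed.

Lemma Bmat_mulE n m (A : 'M[R]_(n, m)) k j :
  (Bmat n *m A) k j = A (hi k) j - A (lo k) j.
Proof.
rewrite mxE -(sum_indicator (fun i => A i j) (hi_subproof k)).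
rewrite -(sum_indicator (fun i => A i j) (lo_subproof k)) -sumrB.
by apply: eq_bigr => i _; rewrite mxE mulrBl.
Qed.

(** Extending [lam] by zero at both ends, as [f] at indices 0 and [n], puts the first and last rows
    in the same form as the others. *)
Lemma Bmat_tr_mulE n (f : nat -> R) (lam : vecR n.-1) (i : 'I_n) :
  f 0%N = 0 -> f n = 0 -> (forall k, lam k 0 = f k.+1) ->
  ((Bmat n)^T *m lam) i 0 = f i.+1 - f i.
Proof.
move=> f0 fn lamE; rewrite mxE.
under eq_bigr => k _ do rewrite !mxE lamE mulrBl.
rewrite sumrB; congr (_ - _).
  have [lt|ge] := ltnP i n.-1.
    rewrite -(sum_indicator (fun k : 'I_n.-1 => f k.+1) lt).
    by apply: eq_bigr => k _; rewrite eq_sym.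
  have -> : i.+1 = n by have := ltn_ord i; lia.
  rewrite fn big1 // => k _; case: eqP => [e|]; last by rewrite mul0r.
  by have := ltn_ord k; lia.
case: (posnP i) => [e|pos].
  by rewrite e f0 big1 // => k _; rewrite mul0r.
have lt : (i.-1 < n.-1)%N by have := ltn_ord i; lia.
have {2}-> : (i = (Ordinal lt).+1 :> nat)%N by rewrite /=; lia.
rewrite -(sum_indicator (fun k : 'I_n.-1 => f k.+1) lt).
by apply: eq_bigr => k _; congr (_%:R * _); apply/eqP/eqP => /=; lia.
Qed.

(** Its transpose takes partial sums and is a left inverse of [(Bmat n)^T], so it recovers a
    multiplier from the residual. *)
Definition cumul (n : nat) : 'M[R]_(n, n.-1) := \matrix_(j, k) (j <= k)%:R.

Lemma Bmat_cumul n : Bmat n *m cumul n = 1%:M.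
Proof.
apply/matrixP => i k; rewrite Bmat_mulE !mxE /= -(inj_eq val_inj) /=.
by case: ltngtP => h; rewrite ?subrr ?subr0.
Qed.

Lemma inD_Bmat n (x : vecR n) : inD x <-> forall k, 0 <= (Bmat n *m x) k 0.
Proof.
split=> [/inDP h k|h]; first by rewrite Bmat_mulE subr_ge0 h /=.
apply/inDP => i [j jn] /= ij.
elim: j jn ij => [|j IH] jn ij.
  by have -> : i = Ordinal jn by apply: val_inj => /=; lia.
move: ij; rewrite leq_eqVlt => /orP[/eqP ij|ij].
  by have -> : i = Ordinal jn by apply: val_inj.
have jn' : (j < n.-1)%N by lia.
have := h (Ordinal jn'); rewrite Bmat_mulE subr_ge0 => h1.
have -> : Ordinal jn = lo (Ordinal jn') by apply: val_inj.
apply: (le_trans h1); have jn2 : (j < n)%N by lia.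
have -> : hi (Ordinal jn') = Ordinal jn2 by apply: val_inj.
exact: IH.
Qed.

(** * Rearrangement inequality *)

Lemma sum_perm n (tau : 'S_n) (F : 'I_n -> R) : \sum_i F (tau i) = \sum_i F i.
Proof. by rewrite [RHS](reindex_inj (@perm_inj _ tau)). Qed.

Lemma sorted_prefix_sum n (s t : vecR n) (tau : 'S_n) (k : nat) :
  (forall i, t i 0 = s (tau i) 0) -> inD s ->
  \sum_(i < n | (i < k)%N) t i 0 <= \sum_(i < n | (i < k)%N) s i 0.
Proof.
move=> ts /inDP sD; have [kn|nk] := ltnP k n; last first.
  have ik (i : 'I_n) : (i < k)%N by apply: leq_trans nk.
  under eq_bigl => i do rewrite ik.
  under [leRHS]eq_bigl => i do rewrite ik.
  under eq_bigr => i _ do rewrite ts.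
  by rewrite (sum_perm tau (fun i => s i 0)).
pose c := s (Ordinal kn) 0.
(* Compare the parts of the entries above the threshold [c = s_k]. *)
rewrite -subr_ge0 -sumrB.
have : \sum_(i < n | (i < k)%N) (t i 0 - c) <= \sum_(i < n | (i < k)%N) (s i 0 - c).
  apply: (@le_trans _ _ (\sum_(i < n) Num.max (t i 0 - c) 0)).
    rewrite [leRHS](bigID (fun i : 'I_n => (i < k)%N)) /=.
    apply: ler_wpDr; first by apply: sumr_ge0 => i _; rewrite le_max lexx orbT.
    by apply: ler_sum => i _; rewrite le_max lexx.
  under eq_bigr => i _ do rewrite ts.
  rewrite (sum_perm tau (fun i => Num.max (s i 0 - c) 0)).
  rewrite (bigID (fun i : 'I_n => (i < k)%N)) /= [X in _ + X]big1 ?addr0.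
    apply: ler_sum => i ik; rewrite ge_max lexx subr_ge0; apply: sD => /=; lia.
  move=> i ik; apply/max_idPr; rewrite subr_le0; apply: sD => /=; lia.
by rewrite -subr_ge0 -sumrB; under eq_bigr => i _ do rewrite opprB addrA subrK.
Qed.

(** Summation by parts: [s - t] is [(Bmat n)^T *m lam], where [lam] collects the differences of
    prefix sums. These are nonnegative, and so is [Bmat n *m z]. *)
Lemma rearrangement n (s t z : vecR n) (tau : 'S_n) :
  (forall i, t i 0 = s (tau i) 0) -> inD s -> inD z -> dot t z <= dot s z.
Proof.
move=> ts sD /inD_Bmat zD.
pose f k := \sum_(i < n | (i < k)%N) (s i 0 - t i 0).
have fn : f n = 0.
  rewrite /f; under eq_bigl => i do rewrite ltn_ord.
  rewrite sumrB; under [X in _ - X]eq_bigr => i _ do rewrite ts.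
  by rewrite (sum_perm tau (fun i => s i 0)) subrr.
have f0 : f 0%N = 0 by rewrite /f big_pred0.
pose lam : vecR n.-1 := \col_k f k.+1.
have e : s - t = (Bmat n)^T *m lam.
  apply/matrixP => i j; rewrite (ord1 j) (Bmat_tr_mulE _ f0 fn); last by move=> k; rewrite mxE.
  rewrite !mxE /f (bigD1 i) //= (eq_bigl (fun j : 'I_n => (j < i)%N)) ?addrK // => k.
  by rewrite ltnS ltn_neqAle andbC -(inj_eq val_inj).
rewrite -subr_ge0 -dotNl -dotDl e dot_mulmxl trmxK; apply: dot_ge0 => // k.
by rewrite mxE /f sumrB subr_ge0; apply: sorted_prefix_sum ts sD.
Qed.

(** Both vectors have the same norm, and rearrangement bounds this squared norm by their inner
    product; hence their distance is zero. *)
Lemma sorted_unique n (y : vecR n) (s s' : 'S_n) :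
  inD (perm_mx s *m y) -> inD (perm_mx s' *m y) -> perm_mx s *m y = perm_mx s' *m y.
Proof.
move=> h h'; apply/sqnormB_eq0; rewrite sqnormE.
have e : dot (perm_mx s *m y) (perm_mx s *m y) = dot (perm_mx s' *m y) (perm_mx s' *m y).
  by rewrite !dot_mulmxl !perm_mxK.
have := @rearrangement _ (perm_mx s *m y) (perm_mx s' *m y) _ (s' * s^-1)%g _ h h'.
rewrite !dot_lin opprK e (dotC (perm_mx s' *m y) (perm_mx s *m y)) => hh.
have {}hh : dot (perm_mx s' *m y) (perm_mx s' *m y) <= dot (perm_mx s *m y) (perm_mx s' *m y).
  by apply: hh => i; rewrite !perm_mxE permM permKV.
lra.
Qed.

(** * Projection onto D: isotonic regression and its multiplier *)

(* [x] is the slope sequence of the least concave majorant of the partial sums [V] of [v], and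
   [lam] is [V] minus this majorant. The first slope is the largest mean [V_j / j]; the last
   conjunct records that [x 0] is a mean, which bounds the first slope after a cut. *)
Lemma concave_majorant n (v : nat -> R) : exists x lam : nat -> R,
  [/\ lam 0%N = 0 /\ lam n = 0,
      forall i, (i < n)%N -> lam i.+1 = lam i + v i - x i,
      forall i, (i <= n)%N -> lam i <= 0,
      forall i, (i.+1 < n)%N -> x i.+1 <= x i /\ lam i.+1 * (x i - x i.+1) = 0
    & (0 < n)%N -> exists2 j, (0 < j <= n)%N & x 0%N * j%:R = \sum_(i < j) v i].
Proof.
elim/ltn_ind: n v => -[|n] IH v; first by exists (fun _ => 0), (fun _ => 0).
pose V j := \sum_(i < j) v i.
have VS j : V j.+1 = V j + v j by rewrite /V big_ord_recr.
(* The first block ends where the mean [V_j / j] is largest: the line of slope [c] through the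
   origin lies above [V] and touches it at [k]. The remaining entries are treated by induction. *)
have [k0 [c [Vk Vmax]]] : exists (k0 : 'I_n.+1) c, V k0.+1 = c * k0.+1%:R /\
    forall j, (j <= n.+1)%N -> V j <= c * j%:R.
  case: (arg_maxP (fun k : 'I_n.+1 => V k.+1 / k.+1%:R) (isT : xpredT ord0)) => k0 _ kmax.
  exists k0, (V k0.+1 / k0.+1%:R); split; first by rewrite divfK ?pnatr_eq0.
  case=> [|j] jn; first by rewrite /V big_ord0 mulr0.
  by rewrite -ler_pdivrMr ?ltr0Sn //; apply: (kmax (Ordinal jn)).
set k := k0.+1 in Vk; have kn : (0 < k <= n.+1)%N by rewrite /k ltn_ord.
have lt : (n.+1 - k < n.+1)%N by lia.
have [x' [lam' [[l0 ln] lS lle xD x0]]] := IH _ lt (fun i => v (k + i)%N).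
pose x i := if (i < k)%N then c else x' (i - k)%N.
pose lam i := if (i <= k)%N then V i - c * i%:R else lam' (i - k)%N.
have lamk i : (k <= i)%N -> lam i = lam' (i - k)%N.
  rewrite /lam leq_eqVlt => /orP[/eqP <- | ki]; last by rewrite leqNgt ki.
  by rewrite leqnn Vk subnn l0 subrr.
exists x, lam; split.
- split; first by rewrite /lam /V big_ord0 mulr0 subrr.
  by rewrite lamk // (andP kn).2.
- move=> i ilt; rewrite /x; case: ltnP => ik.
    rewrite /lam ik (ltnW ik) VS -natr1; ring.
  rewrite !lamk ?subSn ?lS ?subnKC //; lia.
- move=> i ilt; rewrite /lam; case: leqP => ik; first by rewrite subr_le0 Vmax.
  by apply: lle; lia.
- move=> i ilt; rewrite /x; case: (ltngtP i.+1 k) => ik.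
  + by rewrite lexx subrr mulr0.
  + by rewrite lamk ?subSn //; [apply: xD; lia | lia].
  + rewrite lamk ik // subnn l0 mul0r; split=> //.
    (* Across the cut, the first slope of the tail is a mean of tail entries; the bound on [V] at
       [k + j] shows that it is at most [c]. *)
    have [|j jn xj] := x0; first by lia.
    rewrite -(ler_pM2r (x := j%:R)) ?ltr0n; last by case/andP: jn.
    rewrite xj; have := Vmax (k + j)%N.
    rewrite natrD mulrDr -Vk {1}/V big_split_ord /= lerD2l; apply; lia.
- move=> _; exists k => //; rewrite /x; case/andP: kn => -> _; exact: esym.
Qed.

(** The conditions give [0 <= dot (z - x) (x - v)] for [z] in D, so the squared distance to [v]
    grows by at least [sqnorm (z - x)]. The minimizer is therefore unique, and the epsilon choice
    must return it. *)
Lemma projD_KKT n (v x : vecR n) (lam : vecR n.-1) :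
  inD x -> x - v + (Bmat n)^T *m lam = 0 -> (forall k, lam k 0 <= 0) ->
  dot lam (Bmat n *m x) = 0 -> projD v = x.
Proof.
move=> xD e lle cs.
have opt z : inD z -> sqnorm (z - x) + sqnorm (x - v) <= sqnorm (z - v).
  move=> /inD_Bmat zD; rewrite !sqnormE.
  have -> : z - v = (z - x) + (x - v) by rewrite addrA subrK.
  have exv : x - v = - ((Bmat n)^T *m lam) by apply/eqP; rewrite -addr_eq0 e.
  have : 0 <= dot (z - x) (x - v).
    rewrite exv dotNr dot_mulmxr trmxK mulmxBr dotDl dotNl (dotC (_ *m x)) cs subr0 -dotNr.
    by apply: dot_ge0 => // k; rewrite mxE oppr_ge0.
  move: (z - x) (x - v) => a b; rewrite !dotDl !dotDr (dotC b a); lra.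
have [hD hmin] : inD (projD v) /\ forall z, inD z -> Rle (sqnorm (projD v - v)) (sqnorm (z - v)).
  apply: (epsilon_spec (inhabits 0)
    (fun x => inD x /\ forall z, inD z -> Rle (sqnorm (x - v)) (sqnorm (z - v)))).
  exists x; split=> // z zD; apply/RleP.
  by apply: le_trans (opt z zD); rewrite lerDr sqnormE dotxx_ge0.
apply/sqnormB_eq0; have /RleP := hmin _ xD; have := opt _ hD; lra.
Qed.

(** Slopes of the concave majorant give the projection, its gap to the partial sums gives the
    multiplier. Membership in D is included because the epsilon term is only specified once a
    minimizer is exhibited. *)
Lemma MD_nonempty n (v : vecR n) : exists lam, MD v lam /\ inD (projD v).
Proof.
case: n v => [|n] v.
  exists 0; split; last by apply/inDP => -[].
  split=> [|[]//|[]//|]; first by apply/matrixP => -[].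
  by rewrite trmx0 mul0mx mxE.
pose v' i := if insub i is Some j then v j 0 else 0.
have [x' [lam' [[l0 ln] lS lle xD _]]] := concave_majorant n.+1 v'.
pose x : vecR n.+1 := \col_i x' i; pose lam : vecR n := \col_k lam' k.+1.
have e : x - v + (Bmat n.+1)^T *m lam = 0.
  apply/matrixP => i j; rewrite (ord1 j) mxE (Bmat_tr_mulE _ l0 ln) => [|k]; last by rewrite mxE.
  by rewrite !mxE lS // /v' valK; ring.
have llam k : lam k 0 <= 0 by rewrite mxE lle // ltnS ltnW // ltnS ltn_ord.
have xinD : inD x.
  apply/inD_Bmat => k; rewrite (Bmat_mulE x k) !mxE subr_ge0.
  by apply: (xD k _).1; rewrite ltnS.
have cs : dot lam (Bmat n.+1 *m x) = 0.
  apply: big1 => k _; rewrite (Bmat_mulE x k) !mxE.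
  by apply: (xD k _).2; rewrite ltnS.
have eP := projD_KKT xinD e llam cs.
exists lam; rewrite /MD eP; split=> //; split=> //.
- by move/inD_Bmat: xinD => h k; apply/RleP.
- by move=> k; apply/RleP.
- by rewrite -dotE.
Qed.

Lemma projD_in n (v : vecR n) : inD (projD v).
Proof. by have [lam []] := MD_nonempty v. Qed.

Section Multiplier.
Variables (n : nat) (v : vecR n) (lam : vecR n.-1).
Hypothesis lamP : MD v lam.

Lemma MD_le0 k : lam k 0 <= 0.
Proof. by case: lamP => _ _ h _; apply/RleP. Qed.

Lemma MD_residual : v - projD v = (Bmat n)^T *m lam.
Proof.
by case: lamP => /eqP h _ _ _; apply: esym; apply/eqP; rewrite -opprB -addr_eq0 addrC h.
Qed.

(** The multiplier is a fixed linear image of the residual, which gives its uniqueness and its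
    continuity in [v]. *)
Lemma MD_cumul : lam = (cumul n)^T *m (v - projD v).
Proof. by rewrite MD_residual mulmxA -trmx_mul Bmat_cumul trmx1 mul1mx. Qed.

Lemma MD_slack k : lam k 0 * (Bmat n *m projD v) k 0 = 0.
Proof.
case: lamP => _ _ _; rewrite -dotE /dot => h.
have /inD_Bmat xD := projD_in v.
have nneg i : true -> 0 <= - (lam i 0 * (Bmat n *m projD v) i 0).
  by rewrite -mulNr mulr_ge0 ?oppr_ge0 ?MD_le0.
have /eqP : \sum_i - (lam i 0 * (Bmat n *m projD v) i 0) = 0 by rewrite sumrN h oppr0.
by rewrite psumr_eq0 // => /allP /(_ k (mem_index_enum _)); rewrite oppr_eq0 => /eqP.
Qed.

Lemma MD_supp_ID k : lam k 0 != 0 -> k \in ID v.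
Proof.
move=> nz; rewrite inE; apply/eqP.
by have /eqP := MD_slack k; rewrite mulf_eq0 (negbTE nz) => /eqP.
Qed.

(* Row k of [B B^T] is [(-1, 2, -1)], so it only sees the nonpositive neighbours of [lam k 0 = 0]. *)
Lemma MD_inactive k : lam k 0 = 0 -> (Bmat n *m projD v) k 0 <= (Bmat n *m v) k 0.
Proof.
move=> lk; rewrite -subr_ge0.
have -> : (Bmat n *m v) k 0 - (Bmat n *m projD v) k 0 = (Bmat n *m ((Bmat n)^T *m lam)) k 0.
  by rewrite -MD_residual !Bmat_mulE !mxE; ring.
(* [lam] shifted by one index and padded with zeros, so that [k] has a neighbour on each side. *)
pose f j := if j is j'.+1 then if insub j' is Some i then lam i 0 else 0 else 0.
have fle j : f j <= 0 by case: j => //= j; case: insubP => // i _ _; apply: MD_le0.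
have fn : f n = 0.
  by rewrite /f; case: (n) lam => // m l; case: insubP => // i; rewrite ltnn.
have fS i : lam i 0 = f i.+1 by rewrite /f valK.
rewrite Bmat_mulE !(Bmat_tr_mulE _ _ fn fS) //= -[if _ is Some _ then _ else _]/(f k.+1) -fS lk.
have := fle k; have := fle k.+2; rewrite /=; lra.
Qed.
End Multiplier.

(** Residuals are monotone: pairing them through the multipliers, slackness kills the diagonal terms
    and the signs make the cross terms nonpositive. Expanding the square of
    [(u - v) - (projD u - projD v)] then finishes. *)
Lemma projD_nonexpansive n (u v : vecR n) :
  dot (projD u - projD v) (projD u - projD v) <= dot (u - v) (u - v).
Proof.
have [lu [luP _]] := MD_nonempty u; have [lv [lvP _]] := MD_nonempty v.
have mono : 0 <= dot (projD u - projD v) ((u - v) - (projD u - projD v)).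
  have -> : u - v - (projD u - projD v) = (u - projD u) - (v - projD v).
    by apply/matrixP => i j; rewrite !mxE; ring.
  rewrite (MD_residual luP) (MD_residual lvP) -mulmxBr dot_mulmxr trmxK mulmxBr.
  rewrite !dot_lin.
  have z w l : MD w l -> dot (Bmat n *m projD w) l = 0.
    by move=> h; apply: big1 => k _; rewrite mulrC (MD_slack h).
  have p w l w' : MD w l -> dot (Bmat n *m projD w') l <= 0.
    move=> h; rewrite -oppr_ge0 -dotNr; apply: dot_ge0 => k.
      by have /inD_Bmat := projD_in w'.
    by rewrite mxE oppr_ge0 (MD_le0 h).
  rewrite (z u lu) // (z v lv) //; have := p u lu v luP; have := p v lv u lvP; lra.
have := dotxx_ge0 ((u - v) - (projD u - projD v)).
move: mono; rewrite !(dotDr _ _ (- (projD u - projD v))) !dotNr.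
rewrite (dotDl (u - v) (- (projD u - projD v)) (u - v)).
rewrite (dotDl (u - v) (- (projD u - projD v)) (projD u - projD v)) !dotNl.
rewrite (dotC (u - v) (projD u - projD v)); lra.
Qed.

(** * Block averaging: [projK K] as orthogonal projection onto the kernel of [BK K] *)

(** The columns of [cumul n] indexed by [K] form a right inverse. *)
Lemma BK_row_free n (K : {set 'I_n.-1}) : row_free (BK K).
Proof.
apply/row_freeP; exists (cumul n *m \matrix_(k, i) (k == enum_val i)%:R).
apply/matrixP => i j; rewrite mulmxA /BK.
have -> : rowsub (fun k => enum_val k) (Bmat n) *m cumul n =
          rowsub (fun k : 'I_#|K| => enum_val k) (1%:M).
  by rewrite -Bmat_cumul; apply/matrixP => a b; rewrite !mxE; apply: eq_bigr => l _; rewrite mxE.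
rewrite mxE (bigD1 (enum_val i)) //= big1 => [|l li].
  by rewrite !mxE eqxx mul1r addr0 (inj_eq enum_val_inj).
by rewrite !mxE eq_sym (negbTE li) mul0r.
Qed.

Lemma BK_mulE n (K : {set 'I_n.-1}) m (A : 'M[R]_(n, m)) i j :
  (BK K *m A) i j = (Bmat n *m A) (enum_val i) j.
Proof. by rewrite !mxE; apply: eq_bigr => l _; rewrite mxE. Qed.

Lemma BK_mul_eq0 n (K : {set 'I_n.-1}) m (A : 'M[R]_(n, m)) :
  BK K *m A = 0 <-> forall k, k \in K -> forall j, A (hi k) j = A (lo k) j.
Proof.
split=> [e k kK j|h].
  have := congr1 (fun M : 'M_(_, _) => M (enum_rank_in kK k) j) e.
  rewrite BK_mulE enum_rankK_in // Bmat_mulE mxE => /eqP.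
  by rewrite subr_eq0 => /eqP.
apply/matrixP => i j; rewrite BK_mulE Bmat_mulE mxE.
by rewrite (h _ (enum_valP i)) subrr.
Qed.

(** If [u] annihilates the Gram matrix, then [u *m A] has zero norm. *)
Lemma gram_unit m n (A : 'M[R]_(m, n)) : row_free A -> A *m A^T \in unitmx.
Proof.
move=> fA; rewrite -row_free_unit; apply: inj_row_free => u uAA.
apply: (row_free_inj fA); rewrite mul0mx; apply: trmx_inj; rewrite trmx0.
apply: dotxx_le0; rewrite dotE trmxK trmx_mul.
by rewrite mulmxA -(mulmxA u) uAA mul0mx mxE.
Qed.

Section BlockProjection.
Variables (n : nat) (K : {set 'I_n.-1}).

Lemma projK_sym : (projK K)^T = projK K.
Proof.
by rewrite /projK linearB /= trmx1 !trmx_mul trmx_inv trmx_mul !trmxK mulmxA.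
Qed.

Lemma BK_projK : BK K *m projK K = 0.
Proof.
rewrite /projK mulmxBr mulmx1 !mulmxA mulmxV ?mul1mx ?subrr //.
exact/gram_unit/BK_row_free.
Qed.

Lemma projK_fix m (A : 'M[R]_(n, m)) : BK K *m A = 0 -> projK K *m A = A.
Proof. by move=> h; rewrite /projK mulmxBl mul1mx -!mulmxA h !mulmx0 subr0. Qed.

Lemma projK_idem : projK K *m projK K = projK K.
Proof. exact/projK_fix/BK_projK. Qed.

Lemma projK_hi_lo k j : k \in K -> projK K (hi k) j = projK K (lo k) j.
Proof. by move=> kK; apply: (BK_mul_eq0 K _).1 BK_projK k kK j. Qed.

(** Such vectors are combinations of the rows of [BK K], hence orthogonal to its kernel. *)
Lemma projK_Bmat_tr (lam : vecR n.-1) :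
  (forall k, lam k 0 != 0 -> k \in K) -> projK K *m ((Bmat n)^T *m lam) = 0.
Proof.
move=> supp; rewrite mulmxA -[projK K]trmxK projK_sym -trmx_mul.
apply/matrixP => i j; rewrite [LHS]mxE big1 ?mxE // => k _.
rewrite mxE Bmat_mulE (ord1 j).
have [-> | /supp kK] := eqVneq (lam k 0) 0; first by rewrite mulr0.
by rewrite (projK_hi_lo _ kK) subrr mul0r.
Qed.

(** A diagonal that is constant on blocks preserves the range of [projK K]; transposing this
    invariance gives the commutation. *)
Lemma projK_diag_comm (d : 'rV[R]_n) :
  (forall k, k \in K -> d 0 (hi k) = d 0 (lo k)) ->
  diag_mx d *m projK K = projK K *m diag_mx d.
Proof.
move=> dK.
have e : projK K *m (diag_mx d *m projK K) = diag_mx d *m projK K.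
  apply/projK_fix/BK_mul_eq0 => k kK j.
  by rewrite mul_diag_mx mxE [RHS]mxE dK // projK_hi_lo.
have := congr1 trmx e; rewrite !trmx_mul projK_sym tr_diag_mx => <-.
by rewrite -e mulmxA.
Qed.

End BlockProjection.

Lemma KD_ID n (v : vecR n) : KD v (ID v).
Proof.
have [lam [lamP _]] := MD_nonempty v.
split=> //; last exact: BK_row_free.
by exists lam; split=> // k; apply: MD_supp_ID.
Qed.

(** Split [v] into its projection and [(Bmat n)^T *m lam]: averaging fixes the first since [K] is
    active, and kills the second since [K] contains the support. *)
Lemma KD_projD n (v : vecR n) K : KD v K -> projD v = projK K *m v.
Proof.
case=> -[lam [lamP supp]] /subsetP KI _.
have e : v = projD v + (Bmat n)^T *m lam by rewrite -(MD_residual lamP) addrC subrK.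
rewrite [in RHS]e mulmxDr projK_Bmat_tr // addr0 projK_fix //.
apply/BK_mul_eq0 => k /KI; rewrite inE Bmat_mulE subr_eq0 => /eqP h j.
by rewrite (ord1 j).
Qed.

(** * The pairwise term and subgradient certificates *)

(** The symmetric form does not refer to the order of indices, which makes permutation invariance
    immediate. *)
Lemma pairsum_double n (x : vecR n) :
  2 * pairsum x = \sum_(i < n) \sum_(j < n) `|x i 0 - x j 0|.
Proof.
have split i : \sum_(j < n) `|x i 0 - x j 0| =
    \sum_(j < n | (i < j)%N) `|x i 0 - x j 0| + \sum_(j < n | (j < i)%N) `|x i 0 - x j 0|.
  rewrite (bigID (fun j : 'I_n => (i < j)%N)) /=; congr (_ + _).
  rewrite (bigD1 i) ?ltnn //= subrr normr0 add0r; apply: eq_bigl => j.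
  by rewrite -leqNgt ltn_neqAle andbC -(inj_eq val_inj).
under [RHS]eq_bigr => i _ do rewrite split.
rewrite big_split /= [X in _ = _ + X](exchange_big_dep xpredT) //=.
rewrite mulr_natl mulr2n /pairsum; congr (_ + _).
by apply: eq_bigr => i _; apply: eq_bigr => j _; rewrite distrC.
Qed.

Lemma pairsum_perm n (s : 'S_n) (x : vecR n) : pairsum (perm_mx s *m x) = pairsum x.
Proof.
have two : 2%:R != 0 :> R by rewrite pnatr_eq0.
apply: (mulfI two); rewrite !pairsum_double.
under eq_bigr => i _ do under eq_bigr => j _ do rewrite !perm_mxE.
under eq_bigr => i _ do rewrite (sum_perm s (fun j => `|x (s i) 0 - x j 0|)).
exact: (sum_perm s (fun i => \sum_j `|x i 0 - x j 0|)).
Qed.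

(** Entry [i], counted from 0, occurs with a plus sign in [n - i - 1] pairs and with a minus sign in
    [i] pairs; the difference is the entry of [wvec n]. *)
Lemma pairsum_inD n (x : vecR n) : inD x -> pairsum x = dot (wvec n) x.
Proof.
move=> /inDP xD; rewrite /pairsum.
have -> : \sum_(i < n) \sum_(j < n | (i < j)%N) Rabs (x i 0 - x j 0) =
   \sum_(i < n) \sum_(j < n | (i < j)%N) (x i 0 - x j 0).
  apply: eq_bigr => i _; apply: eq_bigr => j ij.
  by rewrite RabsE ger0_norm // subr_ge0 xD // ltnW.
under eq_bigr => i _ do rewrite sumrB.
rewrite sumrB [X in _ - X](exchange_big_dep xpredT) //= -sumrB.
apply: eq_bigr => i _; rewrite mxE.
have below k (c : R) : (k <= n)%N -> \sum_(j < n | (j < k)%N) c = k%:R * c.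
  by move=> kn; rewrite -(big_ord_widen n (fun => c)) // sumr_const card_ord mulr_natl.
rewrite below ?(ltnW (ltn_ord i)) //.
have -> : \sum_(j < n | (i < j)%N) x i 0 = n%:R * x i 0 - i.+1%:R * x i 0.
  rewrite -(below i.+1) // -[n%:R * _](below n) //.
  under [X in _ = X - _]eq_bigl => j do rewrite ltn_ord.
  rewrite [X in _ = X - _](bigID (fun j : 'I_n => (j < i.+1)%N)) /=.
  by rewrite [X in _ = X - _]addrC addrK; apply: eq_bigl => j; rewrite -leqNgt.
by rewrite -natr1; ring.
Qed.

Definition prox_cert {n} (h : vecR n -> R) (y x : vecR n) : Prop :=
  (forall t, dot (y - x) t <= h t) /\ h x = dot (y - x) x.

(* For a support function [h], [prox_cert h y x] says that [y - x] is a subgradient of [h] at [x]. *)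
Lemma argmin_cert n (h f : vecR n -> R) (y x : vecR n) :
  (forall z, f z = 2^-1 * sqnorm (z - y) + h z) -> prox_cert h y x -> argmin f = x.
Proof.
move=> fE [hle hx].
(* The quadratic gain makes the minimizer unique, which pins down the epsilon choice. *)
have opt t : f x + 2^-1 * sqnorm (t - x) <= f t.
  rewrite !fE hx !sqnormE; apply: le_trans (lerD (lexx _) (hle t)).
  have -> : t - y = (t - x) - (y - x) by rewrite opprB addrA subrK.
  have -> : x - y = - (y - x) by rewrite opprB.
  have -> : dot (y - x) t = dot (y - x) (t - x) + dot (y - x) x by rewrite -dotDr subrK.
  move: (t - x) (y - x) => a b; rewrite !dot_lin (dotC b a); lra.
have hmin : is_argmin f (argmin f).
  apply: (epsilon_spec (inhabits 0) (is_argmin f)); exists x => z; apply/RleP.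
  apply: le_trans (opt z); rewrite lerDl sqnormE mulr_ge0 ?dotxx_ge0 //; lra.
by apply/sqnormB_eq0; have /RleP := hmin x; have := opt (argmin f); lra.
Qed.

Section Sorting.
Variables (n : nat) (Psel : vecR n -> 'S_n).
Hypothesis PselP : forall y, inD (perm_mx (Psel y) *m y).
Variable rho : R.
Hypothesis rho_gt0 : 0 < rho.

Lemma S_rho_cert (s : 'S_n) (y : vecR n) : inD (perm_mx s *m y) ->
  prox_cert (fun x => rho * pairsum x) y
    ((perm_mx s)^T *m projD (perm_mx s *m y - rho *: wvec n)).
Proof.
set P := perm_mx s; set v := P *m y - _; set x := projD v => Py.
have [lam [lamP _]] := MD_nonempty v.
pose z := P *m y - x.
have zE : z = rho *: wvec n + (Bmat n)^T *m lam.
  by rewrite -(MD_residual lamP) addrA (addrC _ v) subrK.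
have gE : y - P^T *m x = P^T *m z by rewrite mulmxBr perm_mxK.
(* Where [lam] is nonzero, [projD v] is flat and [z] inherits the gap of the sorted [y]. Where it
   vanishes, [MD_inactive] leaves a gap of at least [2 * rho]. *)
have zD : inD z.
  apply/inD_Bmat => k; have [l0|/(MD_supp_ID lamP)] := eqVneq (lam k 0) 0; last first.
    rewrite inE mulmxBr => /eqP e; rewrite mxE [X in _ + X]mxE e subr0.
    by move/inD_Bmat: Py.
  have := MD_inactive lamP l0.
  by rewrite /v !Bmat_mulE !mxE /= -[k.+2%:R]natr1; have := rho_gt0; nra.
have zdot t : dot z t = rho * dot (wvec n) t + dot lam (Bmat n *m t).
  by rewrite zE dotDl dotZl dot_mulmxl trmxK.
split=> [t|]; last first.
  rewrite gE dot_mulmxl trmxK perm_mxVK zdot [X in _ + X]big1 ?addr0; last first.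
    by move=> k _; apply: MD_slack lamP _.
  by rewrite tr_perm_mx pairsum_perm pairsum_inD //; apply: projD_in.
rewrite gE dot_mulmxl trmxK dotC.
have tD := PselP t.
(* Sorting [t] can only increase its pairing with the sorted [z] and preserves [pairsum]; the term
   in [lam] is then nonpositive. *)
apply: (@le_trans _ _ (dot (perm_mx (Psel t) *m t) z)).
  by apply: (@rearrangement _ _ _ _ (s * (Psel t)^-1)%g) => // i; rewrite !perm_mxE permM permKV.
rewrite dotC zdot -pairsum_inD // pairsum_perm gerDl -oppr_ge0 -dotNl.
apply: dot_ge0 => k; first by rewrite mxE oppr_ge0 (MD_le0 lamP).
by move/inD_Bmat: tD.
Qed.
End Sorting.

(** * Soft thresholding and the prox of [pfun] *)

Definition soft (beta a : R) : R :=
  if beta < a then a - beta else if a < - beta then a + beta else 0.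

Definition softv {n} (beta : R) (x : vecR n) : vecR n := \col_i soft beta (x i 0).

Section Soft.
Variable beta : R.
Hypothesis beta_gt0 : 0 < beta.

Lemma soft_mono (a b : R) : a <= b -> 0 <= soft beta b - soft beta a <= b - a.
Proof.
have b0 := beta_gt0; move=> ab; rewrite /soft.
case: (ltP beta b) => h1; case: (ltP beta a) => h2; case: (ltP b (- beta)) => h3;
  case: (ltP a (- beta)) => h4; apply/andP; split; lra.
Qed.

(** Both [soft beta] and its residual are nondecreasing, so their increments have the same sign.
    This lets [pairsum] split additively. *)
Lemma soft_dist (a b : R) :
  `|a - b| = `|soft beta a - soft beta b| + `|(a - soft beta a) - (b - soft beta b)|.
Proof.
wlog ab : a b / a <= b => [wl|].
  have [/wl//|/ltW /wl] := leP a b.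
  by rewrite distrC => ->; rewrite distrC; congr (_ + _); rewrite distrC.
have /andP[h1 h2] := soft_mono ab.
by rewrite !ler0_norm; lra.
Qed.

(** Together with [soft_resid], this says that the residual is a subgradient of [beta] times the
    absolute value at [soft beta a]. *)
Lemma soft_resid_le (a t : R) : (a - soft beta a) * t <= beta * `|t|.
Proof.
have b0 := beta_gt0; apply: le_trans (ler_norm _) _; rewrite normrM; apply: ler_wpM2r => //.
by rewrite ler_norml /soft; case: (ltP beta a) => h1; case: (ltP a (- beta)) => h2;
  apply/andP; split; lra.
Qed.

Lemma soft_resid (a : R) : beta * `|soft beta a| = (a - soft beta a) * soft beta a.
Proof.
rewrite /soft; case: ltP => h1; first by rewrite gtr0_norm ?subr_gt0 //; ring.
case: ltP => h2; last by rewrite normr0 !mulr0.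
have b0 := beta_gt0; by rewrite ltr0_norm; [ring | lra].
Qed.

Lemma softN (a : R) : soft beta (- a) = - soft beta a.
Proof.
have b0 := beta_gt0; rewrite /soft ltrN2 ltrNr.
by case: (ltP beta a) => h1; case: (ltP a (- beta)) => h2; lra.
Qed.

(** The distance conditions keep [b] strictly on the same side of the kink as [a], or, if [a] is at
    a kink, away from the other one. When [b] is at a kink, it equals [a], so either slope is
    valid. *)
Lemma soft_local (a q b : R) :
  (`|b| < beta -> q = 0) -> (`|b| = beta -> q = 0 \/ q = 1) -> (beta < `|b| -> q = 1) ->
  `|b - a| < beta -> (beta < `|a| -> `|b - a| < `|a| - beta) ->
  (`|a| < beta -> `|b - a| < beta - `|a|) ->
  soft beta b - soft beta a - q * (b - a) = 0.
Proof.
have b0 := beta_gt0; wlog a0 : a b / 0 <= a => [wl|].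
  have [/wl|an] := lerP 0 a; first exact.
  have := wl (- a) (- b).
  rewrite oppr_ge0 (ltW an) !softN !normrN -opprD normrN => {}wl q0 q01 q1 l hout hin.
  by have := wl isT q0 q01 q1 l hout hin; lra.
move=> q0 q01 q1; rewrite (ger0_norm a0) => l hout hin.
have /andP[l1 l2] : - beta < b - a < beta by rewrite -ltr_norml.
have bb : - beta < b by lra.
have blt : (`|b| < beta) = (b < beta) by rewrite ltr_norml bb.
have bgt : beta < b -> beta < `|b| by move=> h; apply: lt_le_trans h (ler_norm b).
rewrite /soft.
have -> : (b < - beta) = false by apply/negbTE; rewrite -leNgt ltW.
have -> : (a < - beta) = false by apply/negbTE; rewrite -leNgt; lra.
case: (ltrgtP a beta) hout hin => ha hout hin.
- have := hin isT; rewrite ltr_norml => /andP[m1 m2].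
  have bl : b < beta by lra.
  by rewrite (ltNge beta b) (ltW bl) /= q0 ?blt //; lra.
- have := hout isT; rewrite ltr_norml => /andP[m1 m2].
  have bl : beta < b by lra.
  by rewrite bl q1 ?bgt //; lra.
- case: (ltrgtP b beta) => hb.
  + by rewrite q0 ?blt //; lra.
  + by rewrite q1 ?bgt //; lra.
  + by rewrite ha hb; lra.
Qed.
End Soft.

Section ProxP.
Variables (n : nat) (beta rho : R).
Hypothesis beta_gt0 : 0 < beta.

(* [pfun] is written with the operations of [R_scope]. *)
Lemma pfunE (x : vecR n) : pfun beta rho x = beta * Defs.norm1 x + rho * pairsum x.
Proof. by []. Qed.

Lemma pairsum_soft (x : vecR n) :
  pairsum x = pairsum (softv beta x) + pairsum (x - softv beta x).
Proof.
rewrite /pairsum -big_split; apply: eq_bigr => i _; rewrite -big_split; apply: eq_bigr => j _.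
by rewrite !RabsE !mxE (soft_dist beta_gt0).
Qed.

(** The residual splits as [(y - x) + (x - xi)], a subgradient of the pairwise term plus one of the
    l1 term, both at [xi]. *)
Lemma soft_cert (y x : vecR n) :
  prox_cert (fun z => rho * pairsum z) y x -> prox_cert (pfun beta rho) y (softv beta x).
Proof.
move=> [hle hx]; set xi := softv beta x.
have e : y - xi = (y - x) + (x - xi) by rewrite addrA subrK.
have n1 t : dot (x - xi) t <= beta * Defs.norm1 t.
  rewrite /Defs.norm1 mulr_sumr; apply: ler_sum => i _.
  by rewrite !mxE; apply: soft_resid_le.
have n1xi : beta * Defs.norm1 xi = dot (x - xi) xi.
  rewrite /Defs.norm1 mulr_sumr; apply: eq_bigr => i _.
  by rewrite !mxE; apply: soft_resid.
have rxi : rho * pairsum xi = dot (y - x) xi.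
  (* The subgradient inequalities at [xi] and [x - xi] add up to an equality, so each is an
     equality. *)
  have := hle xi; have := hle (x - xi).
  have := hx; rewrite pairsum_soft -/xi mulrDr.
  have -> : dot (y - x) x = dot (y - x) xi + dot (y - x) (x - xi) by rewrite -dotDr (addrC xi) subrK.
  lra.
split=> [t|]; rewrite pfunE e dotDl; last by rewrite rxi n1xi addrC.
by rewrite addrC; apply: lerD.
Qed.
End ProxP.

(** * Neighbourhoods; continuity of the projection and the multiplier *)

Lemma ballMP m k (A B : 'M[R]_(m, k)) (e : R) :
  ballM A B e <-> forall i j, `|A i j - B i j| < e.
Proof. by split=> h i j; apply/RltP/h. Qed.

Definition nearM {m k} (A : 'M[R]_(m, k)) (P : 'M[R]_(m, k) -> Prop) : Prop :=
  exists delta, Rlt 0 delta /\ forall B, ballM B A delta -> P B.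

Lemma nearM_imp m k (A : 'M[R]_(m, k)) (P Q : 'M[R]_(m, k) -> Prop) :
  (forall B, P B -> Q B) -> nearM A P -> nearM A Q.
Proof. by move=> PQ [d [d0 h]]; exists d; split=> // B /h /PQ. Qed.

Lemma nearM_and m k (A : 'M[R]_(m, k)) (P Q : 'M[R]_(m, k) -> Prop) :
  nearM A P -> nearM A Q -> nearM A (fun B => P B /\ Q B).
Proof.
move=> [d [/RltP d0 h]] [e [/RltP e0 g]]; exists (Num.min d e); split.
  by apply/RltP; rewrite lt_min d0.
by move=> B /ballMP AB; split; [apply: h | apply: g]; apply/ballMP => i j;
  have := AB i j; rewrite lt_min => /andP[].
Qed.

Lemma nearM_all m k (A : 'M[R]_(m, k)) (T : finType) (P : T -> 'M[R]_(m, k) -> Prop) :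
  (forall t, nearM A (P t)) -> nearM A (fun B => forall t, P t B).
Proof.
move=> h; suff : nearM A (fun B => forall t, t \in enum T -> P t B).
  by apply: nearM_imp => B hB t; apply: hB; rewrite mem_enum.
elim: (enum T) => [|t s IH]; first by exists 1; split=> //; apply/RltP.
apply: nearM_imp (nearM_and (h t) IH) => B [ht hs] t'.
by rewrite inE => /orP[/eqP -> | /hs].
Qed.

Lemma nearM_entry m k (A : 'M[R]_(m, k)) i j (e : R) :
  0 < e -> nearM A (fun B => `|B i j - A i j| < e).
Proof. by move=> e0; exists e; split=> [|B /ballMP]; first exact/RltP. Qed.

Lemma projD_continuous n (v : vecR n) (e : R) :
  0 < e -> nearM v (fun u => forall i, `|projD u i 0 - projD v i 0| < e).
Proof.
(* With coordinates within [d], the squared distance is at most [n * d^2], strictly below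
   [e^2 = (n+1)^2 * d^2] even for [n = 0]. *)
move=> e0; pose d := e / n.+1%:R.
have N0 : 0 < n.+1%:R :> R by rewrite ltr0Sn.
have d0 : 0 < d by rewrite divr_gt0.
exists d; split=> [|u /ballMP uv i]; first exact/RltP.
have ed : e = d * n.+1%:R by rewrite divfK // gt_eqF.
clearbody d.
rewrite -(ltr_pXn2r (n := 2)) ?nnegrE ?(ltW e0) //.
rewrite real_normK ?num_real //.
have -> : projD u i 0 - projD v i 0 = (projD u - projD v) i 0 by rewrite !mxE.
apply: le_lt_trans (sqr_le_dotxx _ _) _.
apply: le_lt_trans (projD_nonexpansive _ _) _.
apply: (@le_lt_trans _ _ (n%:R * d ^+ 2)).
  rewrite -sqnormE mulr_natl -[X in _ *+ X]card_ord -sumr_const; apply: ler_sum => j _.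
  rewrite -[X in X <= _]real_normK ?num_real // ler_pXn2r ?nnegrE ?(ltW d0) //.
  by have /ltW := uv j 0; rewrite !mxE.
have nn : 0 <= n%:R :> R by rewrite ler0n.
by rewrite ed exprMn -natr1 [ltRHS]mulrC ltr_pM2r ?exprn_gt0 //; nra.
Qed.

Lemma MD_continuous n (v : vecR n) lv k : MD v lv -> lv k 0 != 0 ->
  nearM v (fun u => forall lu, MD u lu -> lu k 0 != 0).
Proof.
(* If [lu k 0] vanished, [MD_cumul] would write [- lv k 0] as [n] terms of size at most [2 * e],
   while [lv k 0] has size [(n+1) * 2 * e]. *)
move=> vP nz; pose e := `|lv k 0| / (2 * n.+1%:R).
have N0 : 0 < n.+1%:R :> R by rewrite ltr0Sn.
have e0 : 0 < e by rewrite divr_gt0 ?normr_gt0 // mulr_gt0.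
have near_v := nearM_all (fun j => nearM_entry v j 0 e0).
apply: nearM_imp (nearM_and near_v (projD_continuous v e0)) => u [uv xuv] lu uP.
apply/negP => /eqP l0; have : `|lv k 0| < `|lv k 0|; last by rewrite ltxx.
rewrite -[X in X < _]normrN -[X in `|X| < _]add0r -l0.
have -> : lu k 0 - lv k 0 = \sum_j cumul n j k * ((u j 0 - v j 0) - (projD u j 0 - projD v j 0)).
  rewrite (MD_cumul uP) (MD_cumul vP) !mxE -sumrB; apply: eq_bigr => j _.
  by rewrite !mxE; ring.
apply: le_lt_trans (ler_norm_sum _ _ _) _.
apply: (@le_lt_trans _ _ (n%:R * (2 * e))).
  rewrite mulr_natl -[X in _ *+ X]card_ord -sumr_const; apply: ler_sum => j _.
  rewrite normrM mxE; apply: (@le_trans _ _ (1 * (e + e))); last by lra.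
  apply: ler_pM => //; first by case: (_ <= _)%N; rewrite ?normr1 ?normr0 ?ler01.
  by apply: le_trans (ler_normB _ _) (lerD _ _); apply/ltW.
have -> : `|lv k 0| = n.+1%:R * (2 * e).
  by rewrite /e mulrA [_ * 2]mulrC [RHS]mulrC divfK // gt_eqF // mulr_gt0.
by rewrite -natr1; nra.
Qed.

(** Near [v] the support of the multiplier can only grow and the active set can only shrink, so a
    [K] between them for [u] is also between them for [v]. *)
Lemma KD_near n (v : vecR n) : nearM v (fun u => forall K, KD u K -> KD v K).
Proof.
have [lv [vP _]] := MD_nonempty v.
have supp_near : nearM v (fun u => forall k, lv k 0 != 0 -> forall lu, MD u lu -> lu k 0 != 0).
  apply: nearM_all => k /=; have [_ | nz] := eqVneq (lv k 0) 0.
    by exists 1; split=> [|u _]; [exact/RltP | ].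
  by apply: nearM_imp (MD_continuous vP nz) => u h _.
have ID_near : nearM v (fun u => forall k, k \in ID u -> k \in ID v).
  apply: nearM_all => k /=; rewrite !inE.
  have [_ | nz] := eqVneq ((Bmat n *m projD v) k 0) 0.
    by exists 1; split=> [|u _]; [exact/RltP | ].
  have e0 : 0 < `|(Bmat n *m projD v) k 0| / 2 by rewrite divr_gt0 ?normr_gt0.
  apply: nearM_imp (projD_continuous v e0) => u h; rewrite inE => /eqP b0.
  have := h (hi k); have := h (lo k); move: b0; rewrite !Bmat_mulE => b0.
  move dE : (projD v _ 0 - projD v _ 0) => d; rewrite !ltr_norml => /andP[h1 h2] /andP[h3 h4].
  have : `|d| < `|d|; last by rewrite ltxx.
  by rewrite ltr_norml; apply/andP; split; lra.
apply: nearM_imp (nearM_and supp_near ID_near) => u [hs hI] K [[lu [uP sK]] /subsetP KI fK].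
split=> //; last by apply/subsetP => k /KI /hI.
by exists lv; split=> // k /hs /(_ lu uP) /sK.
Qed.

(** * Ties and independence of the sorting permutation *)

(** At a tie the shifted vector has gap [- 2 * rho]; a zero multiplier would make this an upper
    bound for a nonnegative gap of the projection. *)
Lemma tie_in_KD n (rho : R) (z : vecR n) K k : 0 < rho ->
  KD (z - rho *: wvec n) K -> z (hi k) 0 = z (lo k) 0 -> k \in K.
Proof.
move=> rho0 [[lam [lamP supp]] _ _] zk; apply: supp; apply/negP => /eqP l0.
have := MD_inactive lamP l0.
have /inD_Bmat /(_ k) := projD_in (z - rho *: wvec n).
rewrite !Bmat_mulE; move: (projD _) => x; rewrite !mxE /= zk -[k.+2%:R]natr1; nra.
Qed.

(** All entries of a sorted [z] between two equal ones are tied as well, so every index in between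
    belongs to [K] and one block contains both positions. *)
Lemma projK_tie n (rho : R) (z : vecR n) K : 0 < rho -> inD z -> KD (z - rho *: wvec n) K ->
  forall i i' j : 'I_n, z i 0 = z i' 0 -> projK K i j = projK K i' j.
Proof.
move=> rho0 /inDP zD zK.
suff le_case (i i' j : 'I_n) : (i <= i')%N -> z i 0 = z i' 0 -> projK K i j = projK K i' j.
  move=> i i' j zi; have [/le_case|/ltnW /le_case h] := leqP i i'; first exact.
  by apply: esym; apply: h.
case: i' => [i' i'n]; elim: i' i'n => [|i' IH] i'n ii' zi.
  by have -> : i = Ordinal i'n by apply: val_inj => /=; move: ii' => /=; lia.
move: ii'; rewrite leq_eqVlt => /orP[/eqP e|ii'].
  by have -> : i = Ordinal i'n by apply: val_inj.
have kn : (i' < n.-1)%N by lia.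
have e1 : Ordinal i'n = lo (Ordinal kn) by apply: val_inj.
have i'n' : (i' < n)%N by lia.
have e2 : Ordinal i'n' = hi (Ordinal kn) by apply: val_inj.
have zi' : z i 0 = z (Ordinal i'n') 0.
  by apply/le_anti/andP; split; [rewrite zi |]; apply: zD => //=; lia.
rewrite (IH i'n') //; rewrite e1 e2; apply: projK_hi_lo; apply: tie_in_KD rho0 zK _.
by rewrite -e1 -e2 -zi' zi.
Qed.

Lemma conj_perm_mxE n (s : 'S_n) (A : 'M[R]_n) i j :
  ((perm_mx s)^T *m A *m perm_mx s) i j = A ((s^-1)%g i) ((s^-1)%g j).
Proof. by rewrite tr_perm_mx -{2}[s]invgK -col_permE mxE perm_mxE. Qed.

(** Two sorting permutations send a coordinate to tied positions, and entries of [projK K] agree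
    there in rows and, by symmetry, in columns. *)
Lemma conj_projK_sorting n (rho : R) (y : vecR n) (s s' : 'S_n) K : 0 < rho ->
  inD (perm_mx s *m y) -> inD (perm_mx s' *m y) ->
  KD (perm_mx s *m y - rho *: wvec n) K ->
  (perm_mx s)^T *m projK K *m perm_mx s = (perm_mx s')^T *m projK K *m perm_mx s'.
Proof.
move=> rho0 sD s'D zK; apply/matrixP => a b; rewrite !conj_perm_mxE.
have tie c : (perm_mx s *m y) (s^-1 c)%g 0 = (perm_mx s *m y) (s'^-1 c)%g 0.
  by rewrite {2}(sorted_unique sD s'D) !perm_mxE !permKV.
rewrite (projK_tie rho0 sD zK _ (tie a)) -[projK K]projK_sym mxE [RHS]mxE.
exact: projK_tie rho0 sD zK _ _ _ (tie b).
Qed.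

Lemma conj_idem n (s : 'S_n) (A : 'M[R]_n) : A *m A = A ->
  let Q := (perm_mx s)^T *m A *m perm_mx s in Q *m Q = Q.
Proof.
by move=> AA Q; rewrite /Q -!mulmxA perm_mxVK (mulmxA A) AA.
Qed.

(** * Finite sets and symmetric idempotents *)

Lemma compactM_finite m k (T : finType) (f : T -> 'M[R]_(m, k)) (S : 'M[R]_(m, k) -> Prop) :
  (forall A, S A -> exists t, A = f t) -> compactM S.
Proof.
move=> fS I U _ cover.
have [l lP] : exists l : list I, forall t, t \in enum T -> S (f t) ->
    exists i, List.In i l /\ U i (f t).
  elim: (enum T) => [|t s [l IH]]; first by exists nil.
  (* The cover is only given for points of [S], so values of [f] outside it are skipped. *)
  have [St|nSt] := Classical_Prop.classic (S (f t)).
    have [i Ui] := cover _ St; exists (i :: l) => t'; rewrite inE => /orP[/eqP -> _|t's St'].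
      by exists i; split=> //; left.
    by have [j [jl Uj]] := IH _ t's St'; exists j; split=> //; right.
  exists l => t'; rewrite inE => /orP[/eqP -> //|]; exact: IH.
exists l => A SA; have [t e] := fS _ SA; move: SA; rewrite e => SA.
by apply: lP SA; rewrite mem_enum.
Qed.

(** The quadratic form equals the squared norm of [E *m v]. *)
Lemma psd_sym_idem n (E : 'M[R]_n) : E^T = E -> E *m E = E -> psd E.
Proof.
move=> sE iE v; apply/RleP.
by rewrite -mulmxA -dotE -iE -mulmxA dot_mulmxr sE dotxx_ge0.
Qed.

(** * The multifunction [Mmap] *)

Section Main.
Variables (n : nat) (beta rho : R) (Psel : vecR n -> 'S_n).
Hypothesis PselP : forall y, inD (perm_mx (Psel y) *m y).
Hypothesis beta_gt0 : 0 < beta.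
Hypothesis rho_gt0 : 0 < rho.

(** Allowing any sorting [s] lets nearby points be compared under a common permutation. *)
Lemma S_rhoE (s : 'S_n) (y : vecR n) : inD (perm_mx s *m y) ->
  S_rho rho y = (perm_mx s)^T *m projD (perm_mx s *m y - rho *: wvec n).
Proof. by move=> sD; apply: argmin_cert (S_rho_cert PselP rho_gt0 sD). Qed.

Lemma Prox_pE (y : vecR n) : Prox_p beta rho y = softv beta (S_rho rho y).
Proof.
apply: argmin_cert (soft_cert beta_gt0 _) => //.
by rewrite (S_rhoE (PselP y)); apply: S_rho_cert.
Qed.

Lemma dBprox1_01 (eta : vecR n) Theta : dBprox1 beta eta Theta ->
  exists b : {ffun 'I_n -> bool}, Theta = diag_mx (\row_i (b i)%:R).
Proof.
case=> q [-> qP]; exists [ffun i => q i == 1]; congr diag_mx.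
apply/rowP => i; rewrite !mxE ffunE; have [q1 q2 q3] := qP i.
suff [->|->] : q i = 0 \/ q i = 1 by rewrite ?eqxx // eq_sym oner_eq0.
case: (ltrgtP `|eta i 0| beta) => h; first by left; apply: q1; apply/RltP.
  by right; apply: q3; apply/RltP.
exact: q2.
Qed.

(** [Theta] and [Q] are orthogonal projections; symmetry of their product makes them commute, so the
    product is a projection. *)
Lemma Mmap_idem y M : Mmap beta rho Psel y M -> M *m M = M.
Proof.
move=> [sM [Theta [Q [/dBprox1_01 [b eT] [Qh [[K [_ eQh]] eQ]] eM]]]].
have TT : Theta *m Theta = Theta.
  rewrite eT mulmx_diag; congr diag_mx; apply/rowP => i; rewrite !mxE.
  by case: (b i); rewrite ?mulr0 ?mulr1.
have sT : Theta^T = Theta by rewrite eT tr_diag_mx.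
have QQ : Q *m Q = Q by rewrite eQ eQh; apply/conj_idem/projK_idem.
have sQ : Q^T = Q by rewrite eQ eQh !trmx_mul trmxK projK_sym mulmxA.
have QT : Q *m Theta = Theta *m Q by move: sM; rewrite eM trmx_mul sT sQ.
by rewrite eM -mulmxA (mulmxA Q) QT -mulmxA QQ mulmxA TT.
Qed.

Lemma Mmap_nonempty y : exists M, Mmap beta rho Psel y M.
Proof.
pose P : 'M[R]_n := perm_mx (Psel y); pose v := P *m y - rho *: wvec n.
have eS : S_rho rho y = P^T *m projD v := S_rhoE (PselP y).
(* Constant on the blocks of [ID v], so [diag_mx d] commutes with [projK (ID v)] and the product is
   symmetric; 0 is chosen at the kinks. *)
pose d : 'rV[R]_n := \row_i if beta < `|projD v i 0| then 1 else 0.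
have dK k : k \in ID v -> d 0 (hi k) = d 0 (lo k).
  by rewrite inE Bmat_mulE subr_eq0 !mxE => /eqP ->.
pose Theta := P^T *m diag_mx d *m P.
pose Q := P^T *m projK (ID v) *m P.
have eTQ : Theta *m Q = P^T *m (diag_mx d *m projK (ID v)) *m P.
  by rewrite /Theta /Q -!mulmxA perm_mxVK.
exists (Theta *m Q); split.
  by rewrite eTQ !trmx_mul trmxK projK_sym tr_diag_mx -projK_diag_comm // !mulmxA.
exists Theta, Q; split=> //; last by exists (projK (ID v)); split=> //; exists (ID v); split=> //; apply: KD_ID.
pose q i : R := if beta < `|S_rho rho y i 0| then 1 else 0.
exists q; split.
  apply/matrixP => i j; rewrite conj_perm_mxE !mxE (inj_eq perm_inj) /q eS tr_perm_mx perm_mxE.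
  by case: eqP => // ->.
move=> i; rewrite /q RabsE; split=> [/RltP h|<-|/RltP -> //]; last by left; rewrite ltxx.
by rewrite ltNge ltW.
Qed.

(** One neighbourhood serves both upper semicontinuity, through inclusion of the values, and the
    exact expansion. *)
Lemma Mmap_near y : nearM y (fun u => forall M, Mmap beta rho Psel u M ->
  Mmap beta rho Psel y M /\ Prox_p beta rho u - Prox_p beta rho y - M *m (u - y) = 0).
Proof.
pose v0 := perm_mx (Psel y) *m y - rho *: wvec n.
have sort_near : nearM y (fun u => forall ab : 'I_n * 'I_n, y ab.1 0 < y ab.2 0 -> u ab.1 0 < u ab.2 0).
  apply: nearM_all => -[a b] /=; case: (ltrP (y a 0) (y b 0)) => h; last first.
    by exists 1; split=> [|//]; apply/RltP.
  have e0 : 0 < (y b 0 - y a 0) / 2 by rewrite divr_gt0 // subr_gt0.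
  apply: nearM_imp (nearM_and (nearM_entry y a 0 e0) (nearM_entry y b 0 e0)) => u.
  by rewrite !ltr_norml => -[/andP[h1 h2] /andP[h3 h4]] _; lra.
(* All sorting permutations of [y] yield the same [v0], and permuting rows preserves max-norm balls,
   so one radius serves every [s]. *)
have shift_near (G : vecR n -> Prop) : nearM v0 G -> nearM y (fun u =>
    forall s : 'S_n, inD (perm_mx s *m y) -> G (perm_mx s *m u - rho *: wvec n)).
  move=> [d [d0 hG]]; exists d; split=> // u /ballMP uy s sD; apply/hG/ballMP => i j.
  rewrite /v0 (sorted_unique (PselP y) sD) (ord1 j).
  have e (x : vecR n) : (perm_mx s *m x - rho *: wvec n) i 0 = x (s i) 0 - rho * wvec n i 0.
    by rewrite mxE perm_mxE !mxE.
  by rewrite !e opprB addrA subrK.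
have K_near := shift_near _ (KD_near v0).
pose eta := S_rho rho y.
(* The radii that [soft_local] asks for at each coordinate of [eta]. *)
have S_near i : exists2 e : R, 0 < e & e <= beta /\ (beta < `|eta i 0| -> e <= `|eta i 0| - beta) /\
    (`|eta i 0| < beta -> e <= beta - `|eta i 0|).
  case: (ltrgtP `|eta i 0| beta) => h.
  - by exists (beta - `|eta i 0|); [rewrite subr_gt0 | rewrite gerBl normr_ge0; split].
  - exists (Num.min beta (`|eta i 0| - beta)); first by rewrite lt_min beta_gt0 subr_gt0.
    by rewrite !ge_min !lexx orbT; split.
  - by exists beta.
have [e e_gt0 eP] := fin_all_exists2 S_near.
have C_near := shift_near _ (nearM_all (fun i => projD_continuous v0 (e_gt0 i))).
apply: nearM_imp (nearM_and sort_near (nearM_and K_near C_near)) => u [su [Ku Cu]] M.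
move=> [sM [Theta [Q [[q [eT qP]] [_ [[K [uK ->]] eQ]] eM]]]].
pose s := Psel u; have sDu : inD (perm_mx s *m u) := PselP u.
(* Strict inequalities of [y] persist at [u], so a permutation sorting [u] also sorts [y]. *)
have sDy : inD (perm_mx s *m y).
  apply/inDP => i j /((inDP _).1 sDu); rewrite !perm_mxE leNgt => h.
  by rewrite leNgt; apply: contra h => /(su (s i, s j)).
have v0E : v0 = perm_mx s *m y - rho *: wvec n by rewrite /v0 (sorted_unique (PselP y) sDy).
have vK : KD v0 K := Ku s sDy K uK.
(* Both projections average along the same [K], and the shift by [rho *: wvec n] cancels. *)
have S_diff : S_rho rho u - S_rho rho y = Q *m (u - y).
  rewrite (S_rhoE sDu) (S_rhoE sDy) -mulmxBr -v0E (KD_projD uK) (KD_projD vK) -mulmxBr v0E.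
  by rewrite eQ opprB addrA subrK -!mulmxBr !mulmxA.
have close i : `|S_rho rho u i 0 - S_rho rho y i 0| < e i.
  by rewrite (S_rhoE sDu) (S_rhoE sDy) tr_perm_mx !perm_mxE -v0E; apply: Cu.
split.
  split=> //; exists Theta, Q; split=> //.
    exists q; split=> // i; have [q1 q2 q3] := qP i; have [e1 [e2 e3]] := eP i.
    have := close i; rewrite -/eta => ci.
    have n1 := ler_normB (S_rho rho u i 0 - eta i 0) (S_rho rho u i 0).
    have n2 := ler_normD (S_rho rho u i 0 - eta i 0) (eta i 0).
    move: n1 n2; rewrite addrAC subrr sub0r normrN subrK => n1 n2.
    split=> [/RltP h|_|/RltP h].
    - by apply/q1/RltP; rewrite RabsE; have := e3 h; lra.
    - case: (ltrgtP `|S_rho rho u i 0| beta) => [/RltP/q1|/RltP/q3|/q2 //]; by [left|right].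
    - by apply/q3/RltP; rewrite RabsE; have := e2 h; lra.
  exists (projK K); split; first by exists K.
  (* [Q] is conjugated by the permutation chosen for [u]; it must be the same matrix under the one
     chosen for [y]. *)
  by rewrite eQ; apply: esym; apply: conj_projK_sorting vK => //; apply: PselP.
rewrite eM -mulmxA -S_diff !Prox_pE; apply/matrixP => i j; rewrite (ord1 j).
have [q1 q2 q3] := qP i; have [e1 [e2 e3]] := eP i; have ci := close i.
rewrite eT mul_diag_mx !mxE; apply: (soft_local beta_gt0).
- by move=> /RltP; apply: q1.
- exact: q2.
- by move=> /RltP; apply: q3.
- exact: lt_le_trans ci e1.
- by move=> /e2; apply: lt_le_trans.
- by move=> /e3; apply: lt_le_trans.
Qed.
End Main.

Unset Implicit Arguments.
Bind Scope R_scope with R.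

Theorem theorem2p9 (n : nat) (beta rho : R) (Psel : 'cV[R]_n -> 'S_n) :
  (forall y : 'cV[R]_n, inD (perm_mx (Psel y) *m y)) ->
  Rlt 0 beta -> Rlt 0 rho ->
  forall y : 'cV[R]_n,
  [/\ (exists M, Mmap beta rho Psel y M),
      compactM (Mmap beta rho Psel y),
      upper_semicontinuous (Mmap beta rho Psel),
      (forall M, Mmap beta rho Psel y M ->
         [/\ symmetric_mx M, psd M, symmetric_mx (1%:M - M) & psd (1%:M - M)]) &
      exists delta, Rlt 0 delta /\
        forall u : 'cV[R]_n, ballM u y delta ->
          forall M, Mmap beta rho Psel u M ->
            Prox_p beta rho u - Prox_p beta rho y - M *m (u - y) = 0].
Proof.
move=> PselP /RltP beta0 /RltP rho0 y; split.
- exact: Mmap_nonempty.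
(* A value is determined by a 0-1 diagonal and a set [K], so there are finitely many candidates. *)
- pose f (t : {ffun 'I_n -> bool} * {set 'I_n.-1}) : 'M[R]_n :=
    diag_mx (\row_i (t.1 i)%:R) *m ((perm_mx (Psel y))^T *m projK t.2 *m perm_mx (Psel y)).
  apply: (compactM_finite (f := f)) => M.
  move=> [_ [Theta [Q [/dBprox1_01 [b ->] [_ [[K [_ ->]] ->]] ->]]]].
  by exists (b, K).
- move=> z V _ zV; have [d [d0 h]] := Mmap_near PselP beta0 rho0 z.
  by exists d; split=> // u uz M /(h u uz) [/zV].
- move=> M MM; have sM : M^T = M := MM.1; have iM := Mmap_idem MM.
  have sM' : (1%:M - M)^T = 1%:M - M by rewrite linearB /= trmx1 sM.
  split=> //; apply: psd_sym_idem => //.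
  by rewrite mulmxBl mul1mx mulmxBr mulmx1 iM subrr subr0.
- have [d [d0 h]] := Mmap_near PselP beta0 rho0 y.
  by exists d; split=> // u uy M /(h u uy) [].
Qed.
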